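(* For every integer $d'\geq 2$ there exists a constant $c_{d'}>0$, depending only on $d'$, such that the following holds. Let $d\geq 3$ be an integer and $q$ a prime power with $\gcd(d,q-1)=d'>1$. For $\alpha\in\mathbb{F}_q$, let $C_\alpha\subset\mathbb{P}^2$ be the plane curve over $\mathbb{F}_q$ given by $yz^{d-1}=x^d-\alpha z^d$. If $S\subseteq\mathbb{F}_q$ is such that $\bigcup_{\alpha\in S}C_\alpha(\mathbb{F}_q)$ is a blocking set in $\mathbb{P}^2(\mathbb{F}_q)$, then $|S|\geq c_{d'}\log q$.
   Context: A set $B\subseteq\mathbb{P}^2(\mathbb{F}_q)$ is a blocking set if it intersects every $\mathbb{F}_q$-line of $\mathbb{P}^2$. $\log$ is the natural logarithm. *)

(* Defs.v *)
From HB Require Import structures.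
From mathcomp Require Import all_boot all_order all_algebra.
From mathcomp Require Import all_classical all_reals all_analysis.

Set Implicit Arguments.
Unset Strict Implicit.
Unset Printing Implicit Defensive.

Import Order.TTheory GRing.Theory Num.Theory.
Local Open Scope classical_set_scope.
Local Open Scope ring_scope.

(** The points and the [F]-lines of P^2(F) are the one- and two-dimensional
    linear subspaces of F^3. *)
Definition proj_point (F : finFieldType) :=
  {P : {vspace 'rV[F]_3} | \dim P == 1%N}.

Definition proj_line (F : finFieldType) :=
  {L : {vspace 'rV[F]_3} | \dim L == 2%N}.

Definition line_points (F : finFieldType) (L : proj_line F) :
    set (proj_point F) :=
  [set P : proj_point F | (val P <= val L)%VS].

Definition blocking_set (F : finFieldType) (B : set (proj_point F)) : Prop :=
  forall L : proj_line F, B `&` line_points L !=set0.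

(** The equation y z^(d-1) = x^d - alpha z^d is homogeneous of degree [d], so
    for [0 < d] it holds at all vectors of the one-dimensional space [P] as soon
    as it holds at one of its nonzero vectors. *)
Definition curve_points (F : finFieldType) (d : nat) (alpha : F) :
    set (proj_point F) :=
  [set P : proj_point F | forall v : 'rV[F]_3, v \in val P ->
    let x := v 0 0 in let y := v 0 1 in let z := v 0 2 in
    y * z ^+ (d - 1) = x ^+ d - alpha * z ^+ d].

(* Main.v *)
(** A blocked line [y = b z] yields [alpha \in S] with [b + alpha] a [d]-th power,
    hence an [l]-th power for a fixed prime [l] dividing [d'].  So it suffices to
    find, when [#|F|] exceeds [l ^ (22 * #|S|)], an element [b] such that
    [(b + alpha) ^+ m = g] for all [alpha \in S], where [#|F| = l * m + 1] and
    [g != 1] is an [l]-th root of unity.  Stepanov's method bounds from above the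
    number of [b] with [(\prod_i (b + alpha_i) ^+ e_i) ^+ m = c], for each [c] and
    each exponent vector [e != 0]; as [c] takes only [l] values, this also bounds
    these numbers from below, and averaging over all [e] isolates the wanted [b]. *)

Require Import Defs.
From HB Require Import structures.
From mathcomp Require Import all_boot all_order all_algebra all_field.
From mathcomp Require Import all_classical all_reals all_analysis.
From mathcomp Require Import zify ring.

Set Implicit Arguments.
Unset Strict Implicit.
Unset Printing Implicit Defensive.

Import Order.TTheory GRing.Theory Num.Theory.
Local Open Scope ring_scope.

(** * Linear relations, and polynomials with zeros of high order *)

Lemma exists_linear_relation (F : fieldType) (I K : finType) (A : I -> K -> F) :
  (#|K| < #|I|)%N ->
  exists lam : I -> F, (exists i, lam i != 0) /\
    forall k, \sum_i lam i * A i k = 0.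
Proof.
move=> ltKI.
pose B := \matrix_(i < #|I|, k < #|K|) A (enum_val i) (enum_val k).
have : kermx B != 0.
  rewrite -mxrank_eq0 mxrank_ker -lt0n subn_gt0.
  by apply: leq_ltn_trans ltKI; apply: rank_leq_col.
case/rowV0Pn => v /sub_kermxP vB0 v0.
exists (fun i => v 0 (enum_rank i)); split.
  case/rV0Pn: v0 => i vi; exists (enum_val i).
  by rewrite enum_valK.
move=> k; have /rowP/(_ (enum_rank k)) := vB0.
rewrite mxE [in RHS]mxE => vBk; rewrite -[RHS]vBk.
rewrite [LHS](reindex (@enum_val I predT)) /=; last first.
  by exists enum_rank => i _; rewrite ?enum_valK ?enum_rankK.
by apply: eq_bigr => i _; rewrite mxE enum_valK enum_rankK.
Qed.

(** Among the terms with nonzero coefficient exactly one has maximal size, so its leading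
    coefficient survives in the sum. *)
Lemma sum_distinct_sizes_neq0 (R : idomainType) (I : finType)
    (P : I -> {poly R}) (lam : I -> R) :
  (forall i, P i != 0) -> injective (fun i => size (P i)) ->
  (exists i, lam i != 0) -> \sum_i lam i *: P i != 0.
Proof.
move=> P0 injP [i0 lam0].
pose i := [arg max_(i > i0 | lam i != 0) size (P i)].
have [lami maxi] : lam i != 0 /\
    forall j, lam j != 0 -> (size (P j) <= size (P i))%N.
  by rewrite /i; case: arg_maxnP.
apply/eqP => /(congr1 (coefp (size (P i)).-1)) /=.
rewrite coef0 coef_sum (bigD1 i) //= big1 ?addr0 => [|j ji].
  by rewrite coefZ => /eqP; rewrite mulf_eq0 (negPf lami) lead_coef_eq0 (negPf (P0 i)).
rewrite coefZ; have [->|lamj] := eqVneq (lam j) 0; first by rewrite mul0r.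
rewrite nth_default ?mulr0 // -ltnS prednK ?size_poly_gt0 // ltn_neqAle maxi // andbT.
by apply: contraNN ji => /eqP /injP ->.
Qed.

Lemma dvdp_prod_XsubC_exp (F : fieldType) (s : seq F) (M : nat) (G : {poly F}) :
  uniq s -> {in s, forall b, ('X - b%:P) ^+ M %| G} ->
  \prod_(b <- s) ('X - b%:P) ^+ M %| G.
Proof.
elim: s => [|b s IH] /= in G *; first by rewrite big_nil dvd1p.
case/andP => bs us H; rewrite big_cons Gauss_dvdp; last first.
  rewrite prodrXl; apply/coprimep_expl/coprimep_expr.
  by rewrite coprimep_sym coprimep_XsubC root_prod_XsubC.
rewrite H ?mem_head //= IH // => x xs.
by apply: H; rewrite inE xs orbT.
Qed.

Lemma card_high_order_zeros (F : finFieldType) (T : {set F}) (M : nat) (G : {poly F}) :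
  G != 0 -> (forall b, b \in T -> 'X^M %| G \Po ('X + b%:P)) ->
  (M * #|T| < size G)%N.
Proof.
move=> G0 H.
have /dvdp_leq -/(_ G0): \prod_(b <- enum T) ('X - b%:P) ^+ M %| G.
  apply: dvdp_prod_XsubC_exp (enum_uniq _) _ => b.
  rewrite mem_enum => /H /(dvdp_comp_poly ('X - b%:P)).
  by rewrite -comp_polyA comp_polyD comp_polyC comp_polyX subrK comp_polyXr
             comp_Xn_poly.
rewrite prodrXl; set P := (_ ^+ M) => lePG.
have P0 : P != 0 by rewrite expf_neq0 // monic_neq0 // monic_prod_XsubC.
rewrite (leq_trans _ lePG) // -(prednK (_ : 0 < size P)%N) ?size_poly_gt0 //.
by rewrite /P size_exp size_prod_XsubC -cardE mulnC.
Qed.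

(** * Bivariate polynomials: Taylor expansion at a variable point, the inner variable *)

Lemma sizeY_mul_leq (R : idomainType) (u v : {poly {poly R}}) a b :
  (sizeY u <= a.+1)%N -> (sizeY v <= b.+1)%N -> (sizeY (u * v) <= (a + b).+1)%N.
Proof.
rewrite !sizeYE rmorphM /= => ua vb.
by apply: leq_trans (size_polyMleq _ _) _; move: ua vb; set x := size _; set y := size _; lia.
Qed.

Lemma sizeY_exp_leq (R : idomainType) (u : {poly {poly R}}) a n :
  (sizeY u <= a.+1)%N -> (sizeY (u ^+ n) <= (a * n).+1)%N.
Proof.
rewrite !sizeYE rmorphXn /= => ua; apply: leq_trans (size_poly_exp_leq _ _) _.
by rewrite ltnS leq_mul //; move: ua; set x := size _; lia.
Qed.

Lemma sizeY_sum_leq (R : idomainType) (I : finType) (P : pred I)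
    (u : I -> {poly {poly R}}) a :
  (forall i, P i -> sizeY (u i) <= a)%N -> (sizeY (\sum_(i | P i) u i) <= a)%N.
Proof.
move=> ua; rewrite sizeYE rmorph_sum; apply: leq_trans (size_sum _ _ _) _.
by apply/bigmax_leqP => i /ua; rewrite sizeYE.
Qed.

Lemma sizeYC (R : idomainType) (p : {poly R}) : sizeY p%:P = size p.
Proof. by rewrite sizeYE swapXY_polyC size_map_polyC. Qed.

Lemma sizeY_XaY (R : idomainType) (p : {poly R}) : sizeY (poly_XaY p) = size p.
Proof. by rewrite sizeYE swapXY_poly_XaY size_poly_XaY. Qed.

Lemma map_horner_polyC (R : comNzRingType) (b : R) (p : {poly R}) :
  map_poly (horner_eval b) p%:P = p.[b]%:P.
Proof. by rewrite map_polyC. Qed.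

Lemma map_horner_XaY (R : comNzRingType) (b : R) (p : {poly R}) :
  map_poly (horner_eval b) (poly_XaY p) = p \Po ('X + b%:P).
Proof.
rewrite /poly_XaY map_comp_poly rmorphD /= map_polyX map_polyC /= /horner_eval hornerX.
congr (_ \Po _); apply/polyP => i.
by rewrite (@coef_map _ _ (horner_eval b)) coef_map /= /horner_eval hornerC.
Qed.

(* The Taylor expansion of [f ^+ N] at [b], up to order [M]: the exponent [N]
   does not enter the bound on the degree in [b] of the coefficients of [W]. *)
Lemma exp_taylor_mod (F : fieldType) (f : {poly F}) (M N : nat) :
  exists W : {poly {poly F}}, (sizeY W <= ((size f).-1 * M).+1)%N /\
    forall b, 'X^M %| (f.[b] ^+ M)%:P * (f \Po ('X + b%:P)) ^+ N
                    - (f.[b] ^+ N)%:P * map_poly (horner_eval b) W.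
Proof.
pose g := poly_XaY f - f%:P.
(* The binomial expansion of [(f.[b] + g) ^+ N], cut at order [M]. The factor [f.[b] ^+ M] turns
   each [f.[b] ^+ (N - a)] into [f.[b] ^+ N] times [f.[b] ^+ (M - a)], so that only exponents up to
   [M] remain in the witness. *)
exists (\sum_(a < N.+1 | (a < M)%N) (f ^+ (M - a))%:P * g ^+ a *+ 'C(N, a)).
have gY : (sizeY g <= (size f).-1.+1)%N.
  rewrite /g sizeYE raddfB /=.
  apply: leq_trans (size_polyD (swapXY (poly_XaY f)) _) _.
  by rewrite size_polyN -!sizeYE sizeY_XaY sizeYC maxnn leqSpred.
split=> [|b].
  apply: sizeY_sum_leq => a aM; rewrite -mulrnAl -polyCMn.
  rewrite -[in leqRHS](subnK (ltnW aM)) mulnDr; apply: sizeY_mul_leq; last exact: sizeY_exp_leq.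
  rewrite sizeYC -mulr_natr; apply: leq_trans (size_polyMleq _ _) _.
  rewrite -polyC_natr size_polyC; have := size_poly_exp_leq f (M - a).
  set u := size _; set v := (_ * _)%N; case: (_ != 0) => /=; first by rewrite addn1.
  by rewrite addn0 => uv; apply: leq_trans (leq_pred _) uv.
set t := f.[b]; set P := f \Po _.
have -> : map_poly (horner_eval b) (\sum_(a < N.+1 | (a < M)%N)
     (f ^+ (M - a))%:P * g ^+ a *+ 'C(N, a)) =
    \sum_(a < N.+1 | (a < M)%N) (t ^+ (M - a))%:P * (P - t%:P) ^+ a *+ 'C(N, a).
  rewrite rmorph_sum; apply: eq_bigr => a _.
  rewrite rmorphMn rmorphM !rmorphXn /g rmorphB /= map_horner_XaY.
  by rewrite map_horner_polyC.
rewrite -[in X in X - _](subrK t%:P P) [P - _ + _]addrC exprDn mulr_sumr.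
rewrite (bigID (fun a : 'I_N.+1 => (a < M)%N)) /= addrAC mulr_sumr -sumrB.
rewrite big1 ?add0r => [|a aM]; last first.
  have aN : (a <= N)%N by rewrite -ltnS.
  rewrite !mulrnAr -mulrnBl !mulrA -mulrBl -!polyC_exp -!polyCM -polyCB -!exprD.
  by rewrite (_ : M + (N - a) = N + (M - a))%N ?subrr ?mul0r ?mul0rn //; lia.
(* The terms with [a < M] have cancelled exactly; in the others [P - t%:P] vanishes at 0 and occurs
   to a power at least [M]. *)
have XP : 'X %| P - t%:P.
  rewrite -['X]subr0 -polyC0 dvdp_XsubCl rootE !hornerE horner_comp !hornerE.
  by rewrite /t subrr.
apply: (big_ind (fun G : {poly F} => 'X^M %| G)) => [|u v|a].
- exact: dvdp0.
- exact: dvdp_add.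
rewrite -leqNgt => aM; rewrite mulrnAr -mulr_natr.
apply/dvdp_mulr/dvdp_mull/dvdp_mull.
by apply: dvdp_trans (dvdp_exp2r a XP); rewrite dvdp_exp2l.
Qed.

(** * Stepanov's method for the values of [f ^+ m] *)

(** Since [l * m = q - 1], multiplying a degree by [l] gives [(i * n + l * j) * q + l * a - i * n].
    Moving the negative terms across leaves remainders below [q], so the quotients agree; reducing
    them mod [l], with [n] coprime to [l], recovers [i], then [j] and [a]. *)
Lemma stepanov_degrees_inj (l m n D a i j a' i' j' : nat) :
  coprime n l -> (l * (D + n) <= (l * m).+1)%N ->
  (a < D)%N -> (a' < D)%N -> (i < l)%N -> (i' < l)%N ->
  (a + m * i * n + (l * m).+1 * j = a' + m * i' * n + (l * m).+1 * j')%N ->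
  [/\ a = a', i = i' & j = j'].
Proof.
move=> cop; set q := (l * m).+1 => lDn aD a'D il i'l E.
have r1 : (l * a + i' * n < q)%N.
  by have := leq_mul (leqnn l) aD; have := leq_mul (ltnW i'l) (leqnn n); lia.
have r2 : (l * a' + i * n < q)%N.
  by have := leq_mul (leqnn l) a'D; have := leq_mul (ltnW il) (leqnn n); lia.
have E2 : ((i * n + l * j) * q + (l * a + i' * n) =
           (i' * n + l * j') * q + (l * a' + i * n))%N.
  by have := congr1 (muln l) E; rewrite /q; lia.
have E3 : (i * n + l * j = i' * n + l * j')%N.
  have := congr1 (divn^~ q) E2.
  by rewrite !divnMDl // !divn_small // !addn0.
have ii : i = i'.
  have : (i * n == i' * n %[mod l])%N.
    by rewrite -(modnMDl j (i * n)) -(modnMDl j' (i' * n)) ![(_ * l)%N]mulnC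
      ![(l * _ + _)%N]addnC E3.
  wlog le : i i' {E E2 E3 r1 r2} il i'l / (i <= i')%N.
    move=> H; case/orP: (leq_total i i') => le e; first exact: H.
    by apply/esym/H; rewrite // eq_sym.
  rewrite eq_sym eqn_mod_dvd ?leq_mul // -mulnBl Gauss_dvdl 1?coprime_sym //.
  case: (posnP (i' - i)%N) => [e _|pos /(dvdn_leq pos)]; lia.
subst i'; have l0 : (0 < l)%N by case: (l) il.
have jj : j = j' by apply/eqP; rewrite -(eqn_pmul2l l0); apply/eqP; lia.
by split=> //; subst j'; lia.
Qed.

Lemma dvdp_Xn_coef0 (F : fieldType) (p : {poly F}) M :
  (forall r, (r < M)%N -> p`_r = 0) -> 'X^M %| p.
Proof.
move=> pM; rewrite -[p](poly_take_drop M) [take_poly M p](_ : _ = 0).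
  by rewrite add0r dvdp_mull.
by apply/polyP => r; rewrite coef_take_poly coef0; case: ifP => // /pM.
Qed.

Lemma XaddC_exp_card (F : finFieldType) (b : F) :
  ('X + b%:P) ^+ #|F| = 'X^#|F| + b%:P.
Proof.
have [p p_pr pF] := finPcharP F.
rewrite (exprDn_pchar _ _ (_ : [pchar {poly F}].-nat #|F|)%N).
  by rewrite -polyC_exp expf_card.
rewrite (eq_pnat _ (pchar_poly F)) (eq_pnat _ (pcharf_eq pF)).
have -> : #|F| = (p ^ logn p #|F|)%N := card_pprimeChar pF.
by rewrite pnatX pnat_id.
Qed.

(* Stepanov's method: [M] is the order of vanishing at the counted points,
   [D] and [J] bound the exponents of ['X] and of ['X^#|F|] in the auxiliary
   polynomial. *)
Lemma stepanov_count (F : finFieldType) (l m n D J M : nat) (f : {poly F}) (c : F) :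
  #|F| = (l * m).+1 -> (0 < m)%N -> size f = n.+1 -> coprime n l -> c != 0 ->
  (M <= #|F|)%N -> (l * (D + n) <= #|F|)%N ->
  (M * (J + D + n * M) < l * J * D)%N ->
  (M * #|[set b | f.[b] ^+ m == c]| <= D + #|F| * n + #|F| * J)%N.
Proof.
move=> qE m0 szf cop c0 Mq lDn MJD; set q := #|F| in qE Mq lDn *.
have f0 : f != 0 by rewrite -size_poly_gt0 szf.
pose I : finType := ('I_D * 'I_l * 'I_J)%type.
pose s := (J + D + n * M)%N.
have /fin_all_exists [W HW] (i : 'I_l) := exp_taylor_mod f M (m * i).
pose G (x : I) : {poly F} := 'X^(x.1.1) * f ^+ (m * x.1.2) * 'X^(q * x.2).
(* What [f.[b] ^+ M * G x], expanded at a counted point [b], becomes modulo ['X^M]: the power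
   [f ^+ (m * i)] contributes [c ^+ i] and [W], and ['X^(q * j)] contributes [b ^+ j]. The degree in
   [b] is thus below [s], however large [m] and [q] are. *)
pose Q (x : I) : {poly {poly F}} :=
  (c ^+ x.1.2 *: 'X^(x.2))%:P * poly_XaY 'X^(x.1.1) * W x.1.2.
have sizeG x : size (G x) = (x.1.1 + m * x.1.2 * n + (l * m).+1 * x.2).+1.
  rewrite /G size_mulXn ?mulf_neq0 ?expf_neq0 ?polyX_eq0 //.
  rewrite mulrC size_mulXn ?expf_neq0 //.
  rewrite -(prednK (_ : 0 < size (f ^+ _))%N) ?size_poly_gt0 ?expf_neq0 //.
  by rewrite size_exp szf /= -qE; lia.
have G0 x : G x != 0 by rewrite -size_poly_gt0 sizeG.
have injG : injective (fun x => size (G x)).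
  move=> [[a i] j] [[a' i'] j']; rewrite !sizeG /= => -[].
  rewrite qE in lDn.
  case/(stepanov_degrees_inj cop lDn (ltn_ord _) (ltn_ord _) (ltn_ord _) (ltn_ord _)).
  by move=> /val_inj -> /val_inj -> /val_inj ->.
have QY x : (sizeY (Q x) <= s)%N.
  have aD := ltn_ord x.1.1; have jJ := ltn_ord x.2.
  apply: (@leq_trans (x.2 + x.1.1 + n * M).+1); last by rewrite /s; lia.
  apply: sizeY_mul_leq; last by have [] := HW x.1.2; rewrite szf.
  apply: sizeY_mul_leq; last by rewrite sizeY_XaY size_polyXn.
  by rewrite sizeYC (leq_trans (size_scale_leq _ _)) // size_polyXn.
(* There are [l * J * D] unknowns and [M * s] equations, one for each coefficient of the combined
   [Q] below order [M]. Vanishing as polynomials in [b], these coefficients vanish at all counted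
   points at once. *)
have [|lam [lam0 rel]] := @exists_linear_relation F I ('I_M * 'I_s)%type
    (fun x rt => (Q x)`_(rt.1)`_(rt.2)).
  by rewrite !card_prod !card_ord -/s; apply: leq_trans MJD _; lia.
pose g := \sum_x lam x *: G x.
have g0 : g != 0 by apply: sum_distinct_sizes_neq0.
have relX r : (r < M)%N -> \sum_x lam x *: (Q x)`_r = 0.
  move=> rM; apply/polyP => t; rewrite coef0 coef_sum.
  have [ts|st] := ltnP t s; last first.
    apply: big1 => x _; rewrite coefZ nth_default ?mulr0 //.
    by apply: leq_trans st; apply: leq_trans (QY x); apply: max_size_coefXY.
  rewrite -[RHS](rel (Ordinal rM, Ordinal ts)).
  by apply: eq_bigr => x _; rewrite coefZ.
have van b : b \in [set b | f.[b] ^+ m == c] -> 'X^M %| g \Po ('X + b%:P).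
  rewrite inE => /eqP fb; set t := f.[b] in fb.
  (* This permits cancelling the auxiliary factor [t ^+ M] at the end. *)
  have t0 : t != 0 by apply: contra_eq_neq fb => ->; rewrite expr0n gtn_eqF // eq_sym.
  pose ev := map_poly (horner_eval b).
  have main x : 'X^M %| (t ^+ M)%:P * (G x \Po ('X + b%:P)) - ev (Q x).
    case: x => [[a i] j]; rewrite /G /Q /=.
    have [_ /(_ b)] := HW i; rewrite -/t (exprM t) fb.
    rewrite /ev !rmorphM /= map_horner_XaY map_horner_polyC -/ev.
    rewrite !comp_Xn_poly; set P := f \Po _; set w := ev _.
    rewrite (exprM _ q) XaddC_exp_card -/q hornerZ hornerXn => dvdW.
    rewrite [_ \Po _](_ : _ = P ^+ (m * i)); last by rewrite rmorphXn.
    set u := (t ^+ M)%:P in dvdW *; set X1 := ('X + b%:P) ^+ a.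
    (* The first summand is the Taylor congruence; the second is divisible by ['X^q], and
       [M <= q]. *)
    have -> : u * (X1 * P ^+ (m * i) * ('X^q + b%:P) ^+ j)
               - (c ^+ i * b ^+ j)%:P * X1 * w
      = X1 * (('X^q + b%:P) ^+ j * (u * P ^+ (m * i) - (c ^+ i)%:P * w)
         + (c ^+ i)%:P * w * (('X^q + b%:P) ^+ j - b%:P ^+ j)).
      by rewrite polyCM (polyC_exp j); ring.
    apply/dvdp_mull/dvdp_add; first exact: dvdp_mull.
    apply: dvdp_mull; rewrite subrXX addrK.
    by apply/dvdp_mulr/dvdp_exp2l.
  have evQ : 'X^M %| \sum_x lam x *: ev (Q x).
    apply: dvdp_Xn_coef0 => r rM.
    rewrite coef_sum -[RHS](horner0 b) -(relX r rM) horner_sum.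
    by apply: eq_bigr => x _; rewrite coefZ coef_map hornerZ.
  have : 'X^M %| (t ^+ M)%:P * (g \Po ('X + b%:P)).
    rewrite -(dvdp_subl _ evQ) /g (raddf_sum (comp_poly ('X + b%:P))) mulr_sumr -sumrB /=.
    apply: (big_ind (fun G : {poly F} => 'X^M %| G)) => [|u v|x _].
    - exact: dvdp0.
    - exact: dvdp_add.
    by rewrite comp_polyZ -scalerAr -scalerBr -mul_polyC dvdp_mull.
  by rewrite mul_polyC dvdpZr // expf_neq0.
apply/ltnW/(leq_trans (card_high_order_zeros g0 van)).
apply: leq_trans (size_sum _ _ _) _; apply/bigmax_leqP => x _.
apply: leq_trans (size_scale_leq _ _) _; rewrite sizeG.
have aD := ltn_ord x.1.1; have il := ltn_ord x.1.2; have jJ := ltn_ord x.2.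
have : (m * x.1.2 * n <= q * n)%N by rewrite leq_mul // qE; apply: leqW; rewrite mulnC leq_mul // ltnW.
have : (q * x.2 <= q * J)%N by rewrite leq_mul // ltnW.
by rewrite -qE; lia.
Qed.

Lemma stepanov_bound (F : finFieldType) (l m n M : nat) (f : {poly F}) (c : F) :
  #|F| = (l * m).+1 -> (1 < l)%N -> size f = n.+1 -> coprime n l -> c != 0 ->
  (M * M <= #|F|)%N -> (#|F| < M.+1 * M.+1)%N -> (2 * l * (n + 2) <= M)%N ->
  (l * #|[set b | f.[b] ^+ m == c]| <= #|F| + 9 * l * (n + 2) * M)%N.
Proof.
move=> qE l1 szf cop c0; set q := #|F| in qE *; set T := #|_| => Mq qM nM.
have M0 : (0 < M)%N by apply: leq_trans nM; rewrite !muln_gt0 /= addn2 (ltnW l1).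
(* [D] is as large as [l * (D + n) <= q] allows. [J] exceeds [M / l] just enough that
   [l * J > M + A]; the surplus [(A + 1) * D] of unknowns must then pay for the lower-order
   equations [M * (J + n * M)]. *)
pose D := (m - n)%N; pose J := (M %/ l + (2 * n + 5))%N; pose A := (2 * l * (n + 2))%N.
have qlow : (2 * (2 * l * (n + 2)) <= q)%N.
  apply: leq_trans Mq; apply: leq_mul => //; apply: leq_trans nM.
  by rewrite -mulnA leq_pmulr // muln_gt0 addn2 (ltnW l1).
have nm : (n <= m)%N.
  rewrite -(leq_pmul2l (ltnW l1)); lia.
have lD : (l * D = l * m - l * n)%N by rewrite /D mulnBr.
have lnm : (l * n <= l * m)%N by rewrite leq_mul.
have qD : (q <= 2 * l * D)%N by rewrite -mulnA lD; lia.
have D0 : (0 < D)%N.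
  by rewrite lt0n; apply: contraTneq qD => ->; rewrite muln0 -ltnNge qE.
have lJ1 : (M + A < l * J)%N.
  by rewrite /J mulnDr; have := divn_eq M l; have := ltn_pmod M (ltnW l1); rewrite /A; lia.
have lJ2 : (l * J <= M + A + l)%N.
  by rewrite /J mulnDr; have := divn_eq M l; rewrite /A; lia.
have J2 : (J <= 2 * M)%N.
  have := leq_div M (l); rewrite /J.
  have : (4 * (n + 2) <= M)%N.
    by apply: leq_trans nM; rewrite leq_mul2r (leq_mul2l 2 2 l) l1 !orbT.
  lia.
(* By [J <= 2 * M] the left side is at most [(n + 2) * M ^ 2], and [M ^ 2 <= q <= 2 * l * D] bounds
   this by [A * D]. *)
have key : (M * (J + n * M) < (A + 1) * D)%N.
  apply: (@leq_ltn_trans (A * D)); last by rewrite ltn_pmul2r // addn1.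
  apply: (@leq_trans ((n + 2) * (2 * l * D))); last by rewrite /A; lia.
  apply: (@leq_trans ((n + 2) * (M * M))).
    have := leq_mul (leqnn M) J2; lia.
  by rewrite leq_mul2l (leq_trans Mq qD) orbT.
have bnd : (M * T <= D + q * n + q * J)%N.
  apply: (stepanov_count qE) => //.
  - by apply: leq_trans D0 _; rewrite leq_subr.
  - by apply: leq_trans Mq; rewrite leq_pmulr.
  - by rewrite -/q qE subnK.
  have : ((A + 1 + M) * D <= l * J * D)%N by rewrite leq_mul2r; apply/orP; right; lia.
  rewrite !mulnDl; move: key; rewrite mulnDr mulnDl; lia.
rewrite -(leq_pmul2l M0).
have B1 : (M * (l * T) <= l * D + q * (l * n) + q * (M + A + l))%N.
  apply: (@leq_trans (l * D + q * (l * n) + q * (l * J))).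
    by have := leq_mul (leqnn l) bnd; rewrite !mulnDr; lia.
  by rewrite leq_add2l leq_mul.
(* This turns the error [3 * q * l * (n + 2)] below into [9 * l * (n + 2) * M ^ 2]; dividing by [M]
   gives the constant 9. *)
have B2 : (q <= 3 * M * M)%N.
  by have := leq_mul M0 (leqnn M); move: qM; lia.
have B3 : (l * D + q * (l * n) + q * (M + A + l) <= M * q + q * (3 * (l * (n + 2))))%N.
  have : (l * D <= q * l)%N by rewrite mulnC leq_mul // /D qE; have := leq_mul (ltnW l1) (leqnn m); lia.
  by rewrite /A; lia.
apply: leq_trans B1 (leq_trans B3 _).
have := leq_mul B2 (leqnn (3 * (l * (n + 2)))); rewrite mulnDr; lia.
Qed.

(** * Products of powers of linear factors *)

Lemma size_prod_exp_linear (R : idomainType) (I : finType) (P : pred I)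
    (p : I -> {poly R}) (e : I -> nat) :
  (forall i, P i -> size (p i) = 2) ->
  size (\prod_(i | P i) p i ^+ e i) = (\sum_(i | P i) e i).+1.
Proof.
move=> p2; apply: (big_rec2 (fun (a : {poly R}) b => size a = b.+1)); first by rewrite size_poly1.
move=> i a b Pi sa; have pi0 : p i != 0 by rewrite -size_poly_gt0 p2.
rewrite size_mul ?expf_neq0 // -?size_poly_gt0 ?sa //.
rewrite -(prednK (_ : 0 < size (p i ^+ _))%N) ?size_poly_gt0 ?expf_neq0 //.
by rewrite size_exp p2 // mul1n addSn addnS.
Qed.

(* If [l] divides the degree of [f = \prod_i ('X + s i) ^+ e i], the substitution
   [b = - s i0 + z^-1] moves a root to infinity and turns [f.[b]] into
   [z ^- deg f * h.[z]] with the degree of [h] prime to [l]; the factor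
   [z ^- deg f] is an [l]-th power. *)
Lemma prod_power_count (F : finFieldType) (I : finType) (s : I -> F) (e : I -> nat)
    (l m M : nat) (c : F) :
  let N := (\sum_i e i)%N in
  injective s -> #|F| = (l * m).+1 -> prime l ->
  (forall i, e i < l)%N -> (exists i, 0 < e i)%N -> c != 0 ->
  (M * M <= #|F|)%N -> (#|F| < M.+1 * M.+1)%N -> (2 * l * (N + 2) <= M)%N ->
  (l * #|[set b | (\prod_i (b + s i) ^+ e i) ^+ m == c]|
     <= #|F| + 9 * l * (N + 2) * M)%N.
Proof.
move=> N injs qE l_pr el [i0 e0] c0 Mq qM NM.
have m0 : (0 < m)%N.
  by rewrite lt0n; apply/eqP => m0; have := finNzRing_gt1 F; rewrite qE m0 muln0.
have [lN|lN] := boolP (coprime N l).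
  pose f : {poly F} := \prod_i ('X + (s i)%:P) ^+ e i.
  have szf : size f = N.+1 by apply: size_prod_exp_linear => i _; rewrite size_XaddC.
  have := stepanov_bound qE (prime_gt1 l_pr) szf lN c0 Mq qM NM.
  congr (_ * _ <= _)%N; apply: eq_card => b; rewrite !inE /f horner_prod.
  by under eq_bigr do rewrite horner_exp !hornerE.
pose h : {poly F} := \prod_(i | i != i0) (1 + (s i - s i0) *: 'X) ^+ e i.
pose N' := (\sum_(i | i != i0) e i)%N.
have NN' : N = (e i0 + N')%N by rewrite /N (bigD1 i0).
have szh : size h = N'.+1.
  apply: size_prod_exp_linear => i ii0.
  have sz : size ((s i - s i0) *: 'X) = 2.
    by rewrite size_scale ?size_polyX // subr_eq0 (inj_eq injs).
  by rewrite addrC size_polyDl sz ?size_poly1.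
(* Here [l] divides [N = e i0 + N'] but not [e i0], which lies strictly between 0 and [l]. *)
have lN' : coprime N' l.
  rewrite coprime_sym prime_coprime //; apply: contraNN lN => lN'.
  rewrite coprime_sym prime_coprime // NN' dvdn_addl //.
  by apply/negP => /(dvdn_leq e0); rewrite leqNgt el.
have lN2 : (l %| N)%N.
  by move: lN; rewrite coprime_sym prime_coprime // negbK.
have := stepanov_bound qE (prime_gt1 l_pr) szh lN' c0 Mq qM.
have le1 : (2 * l * (N' + 2) <= 2 * l * (N + 2))%N.
  by rewrite leq_mul2l NN' -addnA leq_addl orbT.
move=> /(_ (leq_trans le1 NM)) H.
apply: leq_trans (leq_trans H _); last first.
  by rewrite leq_add2l leq_mul2r leq_mul2l NN' -addnA leq_addl !orbT.
rewrite leq_mul2l; apply/orP; right.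
have inj : injective (fun b => (b + s i0)^-1) by move=> x y /invr_inj /addIr.
rewrite -(card_imset _ inj); apply: subset_leq_card; apply/fintype.subsetP => z /imsetP[b].
rewrite !inE => /eqP fb ->; apply/eqP; rewrite -fb.
have bs0 : b + s i0 != 0.
  apply: contra_eq_neq fb => bs0.
  by rewrite (bigD1 i0) //= bs0 expr0n gtn_eqF // mul0r expr0n gtn_eqF // eq_sym.
set w := b + s i0.
have wl : (w ^+ N) ^+ m = 1.
  rewrite -exprM; case/dvdnP: lN2 => k ->; rewrite -mulnA mulnC exprM.
  have : w ^+ (l * m) = 1.
    by apply: (mulfI bs0); rewrite -exprS -qE expf_card mulr1.
  by move=> ->; rewrite expr1n.
rewrite -[LHS]mul1r -[X in X * _]wl -exprMn; congr (_ ^+ m).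
rewrite [in LHS]NN' exprD /N' [RHS](bigD1 i0) //= -mulrA; congr (_ * _).
rewrite -prodrXr /h horner_prod -big_split /=; apply: eq_bigr => i _.
rewrite horner_exp !hornerE -exprMn; congr (_ ^+ _).
by rewrite mulrDr mulr1 mulrCA divff // mulr1 /w; ring.
Qed.

(** * Averaging over exponent vectors *)

(** After replacing [b] by [q - k], the coefficient of [q] that survives is
    [L * l - L - (L - 1) * (l - 1) = l - 1], which is positive. *)
Lemma pair_count_bound (l L q b k E : nat) :
  (1 < l)%N -> (0 < L)%N ->
  (L * (l * b) <= q * L + L.-1 * (l.-1 * (q + E)))%N -> (q <= b + k)%N ->
  (q <= l * L * (k + E))%N.
Proof.
case: l => [|[|l]] //; case: L => [|L] //= _ _ low kb.
have h1 : (L.+1 * (l.+2 * q) <= L.+1 * (l.+2 * (b + k)))%N by rewrite !leq_mul.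
have h2 : (q <= l.+1 * q)%N by rewrite leq_pmull.
have h3 : (L * (l.+1 * E) <= L.+1 * (l.+2 * E))%N.
  by apply: leq_mul => //; apply: leq_mul.
lia.
Qed.

Lemma unity_expr_inj (F : fieldType) (l : nat) (x : F) (a b : nat) :
  prime l -> x ^+ l = 1 -> x != 1 -> (a < l)%N -> (b < l)%N ->
  x ^+ a = x ^+ b -> a = b.
Proof.
move=> l_pr xl x1.
wlog ab : a b / (a <= b)%N.
  by move=> H al bl; case/orP: (leq_total a b) => ab e; [|symmetry]; apply: H.
move=> al bl e; have l0 := prime_gt0 l_pr.
have x0 : x != 0.
  by apply: contra_eq_neq xl => ->; rewrite expr0n gtn_eqF // eq_sym oner_eq0.
have [prx|nprx] := boolP (l.-primitive_root x).
  by move/eqP: e; rewrite (eq_prim_root_expr prx) !modn_small // => /eqP.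
have [d prd dl] := prim_order_exists l0 xl.
case/primeP: l_pr => _ /(_ d dl) /orP[] /eqP dE; move: prd; rewrite dE.
  by move/prim_expr_order; rewrite expr1 => /eqP; rewrite (negPf x1).
by rewrite (negPf nprx).
Qed.

Lemma card_unity_leq (F : finFieldType) (l : nat) :
  (0 < l)%N -> (#|[set c : F | (c ^+ l == 1)%R]| <= l)%N.
Proof.
move=> l0; rewrite cardE; apply: max_unity_roots => //; last exact: enum_uniq.
by apply/allP => c; rewrite mem_enum inE unity_rootE.
Qed.

(** The coordinates of [e] off [i0] determine [e i0], because the powers of [x i0] below [l] are
    distinct. Overwriting the coordinate at [i0] by an arbitrary value is therefore injective on
    pairs. *)
Lemma card_unity_exponents (F : fieldType) (I : finType) (l : nat) (x : I -> F) (i0 : I) :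
  prime l -> (forall i, x i ^+ l = 1) -> x i0 != 1 ->
  (l * #|[set e : {ffun I -> 'I_l} | (\prod_i x i ^+ e i == 1)%R]| <= l ^ #|I|)%N.
Proof.
move=> l_pr xl x1; set E := [set e | _].
pose psi (u : {ffun I -> 'I_l} * 'I_l) : {ffun I -> 'I_l} :=
  [ffun i => if i == i0 then u.2 else u.1 i].
have inj : {in finset.setX E [set: 'I_l]%SET &, injective psi}.
  move=> [e t] [e' t'] /setXP[eE _] /setXP[eE' _] /ffunP psiE.
  have tt' : t = t' by have := psiE i0; rewrite !ffunE eqxx.
  have off i : i != i0 -> e i = e' i.
    by move=> ii0; have := psiE i; rewrite !ffunE (negPf ii0).
  congr (_, _) => //; apply/ffunP => i; have [->|/off//] := eqVneq i i0.
  have x0 j : x j != 0.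
    by apply: contra_eq_neq (xl j) => ->; rewrite expr0n gtn_eqF ?prime_gt0 // eq_sym oner_eq0.
  have rest : \prod_(j | j != i0) x j ^+ e' j = \prod_(j | j != i0) x j ^+ e j.
    by apply: eq_bigr => j /off ->.
  have rest0 : \prod_(j | j != i0) x j ^+ e j != 0.
    by apply/prodf_neq0 => j _; rewrite expf_neq0.
  apply/val_inj/(unity_expr_inj l_pr (xl i0) x1 (ltn_ord _) (ltn_ord _)); apply: (mulIf rest0).
  rewrite -[in RHS]rest; move: eE eE'.
  by rewrite !inE /= (bigD1 i0) // [in X in _ -> X](bigD1 i0) //= => /eqP -> /eqP ->.
have := card_in_imset inj; rewrite cardsX cardsT card_ord mulnC => <-.
by apply: leq_trans (max_card _) _; rewrite card_ffun card_ord.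
Qed.

Lemma card_nonvanishing_shifts (F : finFieldType) (I : finType) (s : I -> F) :
  (#|F| <= #|[set b | [forall i, (b + s i != 0)%R]]| + #|I|)%N.
Proof.
rewrite -(cardsC [set b | [forall i, b + s i != 0]]) leq_add2l.
apply: leq_trans (leq_imset_card (fun i => - s i) I); apply: subset_leq_card.
apply/fintype.subsetP => b; rewrite !inE negb_forall => /existsP[i]; rewrite negbK => bi.
by apply/imsetP; exists i => //; apply/eqP; rewrite -addr_eq0.
Qed.

(* Fourier inversion over [(Z/l)^I] without characters: counting the pairs [(e, b)]
   with [\prod_i ((b + s i) ^+ m / g) ^+ e i = 1] in two ways. *)
Lemma exists_common_power (F : finFieldType) (I : finType) (s : I -> F)
    (l m M : nat) (g : F) :
  let k := #|I| in
  injective s -> #|F| = (l * m).+1 -> prime l -> g ^+ l = 1 ->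
  (M * M <= #|F|)%N -> (#|F| < M.+1 * M.+1)%N -> (2 * l * (k * l + 2) <= M)%N ->
  (l ^ k.+1 * (k + 9 * l * (k * l + 2) * M) < #|F|)%N ->
  exists b, forall i, (b + s i) ^+ m = g.
Proof.
move=> k injs qE l_pr gl Mq qM kM big.
have [/existsP[b /forallP bP]|none] :=
    boolP [exists b, [forall i, (b + s i) ^+ m == g]].
  by exists b => i; apply/eqP.
exfalso; have l0 := prime_gt0 l_pr.
have g0 : g != 0.
  by apply: contra_eq_neq gl => ->; rewrite expr0n gtn_eqF // eq_sym oner_eq0.
(* On [B] every [(b + s i) ^+ m] is an [l]-th root of unity. *)
pose B := [set b | [forall i, b + s i != 0]].
pose h (e : {ffun I -> 'I_l}) b := (\prod_i (b + s i) ^+ e i) ^+ m.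
pose ce (e : {ffun I -> 'I_l}) := g ^+ (\sum_i e i).
pose E' := (9 * l * (k * l + 2) * M)%N.
have pow b i : b \in B -> ((b + s i) ^+ m) ^+ l = 1.
  rewrite inE => /forallP /(_ i) bi; apply: (mulfI bi).
  by rewrite -exprM [(m * l)%N]mulnC -exprS -qE expf_card mulr1.
have upper b : b \in B -> (l * \sum_(e | h e b == ce e) 1 <= l ^ k)%N.
  move=> bB.
  have : ~~ [forall i, (b + s i) ^+ m == g] by apply: contra none => ?; apply/existsP; exists b.
  rewrite negb_forall => /existsP[i0 gi0].
  pose x i := (b + s i) ^+ m / g.
  have xl i : x i ^+ l = 1 by rewrite expr_div_n pow // gl divr1.
  have x1 : x i0 != 1 by rewrite /x -(inj_eq (mulIf g0)) divfK // mul1r.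
  apply: leq_trans (card_unity_exponents l_pr xl x1); rewrite sum1_card.
  rewrite leq_mul2l; apply/orP; right; apply: subset_leq_card.
  apply/fintype.subsetP => e; rewrite !inE unfold_in /h /ce => /eqP he; apply/eqP.
  under eq_bigr do rewrite expr_div_n -exprM mulnC exprM.
  by rewrite prodf_div prodrXl he prodrXr divff // expf_neq0.
(* On [B] the function [h e] takes at most [l] values. Each of the [l - 1] others is taken at most
   [(#|F| + E') / l] times by Stepanov's bound, and [ce e] receives the rest. *)
have lower (e : {ffun I -> 'I_l}) : (exists i, 0 < e i)%N ->
    (l * #|B| <= l * \sum_(b in B | h e b == ce e) 1 + l.-1 * (#|F| + E'))%N.
  move=> e0.
  have hl b : b \in B -> h e b ^+ l == 1.
    move=> bB; rewrite /h -!prodrXl big1 // => i _.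
    by rewrite -!exprM mulnC !exprM pow // expr1n.
  have cel : ce e ^+ l == 1 by rewrite /ce -exprM mulnC exprM gl expr1n.
  rewrite -sum1_card (partition_big (h e) (fun c => c ^+ l == 1)) //.
  rewrite (bigD1 (ce e)) //= mulnDr leq_add2l big_distrr /=.
  have ce0 : (0 < #|[set c : F | (c ^+ l == 1)%R]|)%N.
    by rewrite card_gt0; apply/finset.set0Pn; exists (ce e); rewrite inE.
  have cardZ : (#|[pred c : F | (c ^+ l == 1)%R && (c != ce e)]| <= l.-1)%N.
    rewrite -ltnS (prednK l0); apply: leq_trans (card_unity_leq F l0).
    rewrite [X in (_ < X)%N](cardsD1 (ce e)) inE cel ltnS; apply: subset_leq_card.
    by apply/fintype.subsetP => c; rewrite !inE andbC.
  apply: (@leq_trans (\sum_(c : F | (c ^+ l == 1)%R && (c != ce e)) (#|F| + E'))); last first.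
    by rewrite sum_nat_const leq_mul2r cardZ orbT.
  apply: leq_sum => c /andP[/eqP cl _].
  have c0 : c != 0.
    by apply: contra_eq_neq cl => ->; rewrite expr0n gtn_eqF // eq_sym oner_eq0.
  pose N := (\sum_i e i)%N.
  have Nk : (N <= k * l)%N.
    rewrite /N /k -sum_nat_const; apply: leq_sum => i _; exact: ltnW.
  have := prod_power_count injs qE l_pr (fun i => ltn_ord (e i)) e0 c0 Mq qM.
  have le1 : (2 * l * (N + 2) <= 2 * l * (k * l + 2))%N by rewrite leq_mul2l leq_add2r Nk orbT.
  move=> /(_ (leq_trans le1 kM)) H; apply: leq_trans (leq_trans H _); last first.
    by rewrite leq_add2l leq_mul2r leq_mul2l leq_add2r Nk !orbT.
  rewrite leq_mul2l sum1_card; apply/orP; right; apply: subset_leq_card.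
  by apply/fintype.subsetP => b; rewrite !inE unfold_in => /andP[_].
have kB : (#|F| <= #|B| + k)%N := card_nonvanishing_shifts s.
pose e0 : {ffun I -> 'I_l} := [ffun => Ordinal l0].
have total : (l * \sum_e \sum_(b in B | h e b == ce e) 1 <= #|F| * l ^ k)%N.
  rewrite (exchange_big_dep (mem B)) /=; last by move=> ? ? _ /andP[].
  rewrite big_distrr /=; apply: (@leq_trans (\sum_(b in B) l ^ k)).
    by apply: leq_sum => b bB; rewrite bB /=; apply: upper.
  by rewrite sum_nat_const leq_mul2r max_card orbT.
(* The zero vector counts all of [B]. This excess over the average contradicts [total] once [#|F|]
   is large. *)
have lower0 : (l * #|B| <= l * \sum_(b in B | h e0 b == ce e0) 1)%N.
  rewrite -sum1_card leq_mul2l; apply/orP; right; rewrite leq_eqVlt; apply/orP; left.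
  apply/eqP/eq_bigl => b; rewrite /h /ce big1 => [|i _]; last by rewrite ffunE.
  by rewrite big1 ?expr1n ?eqxx ?andbT // => i _; rewrite ffunE.
have sumlow : (l ^ k * (l * #|B|) <= #|F| * l ^ k + (l ^ k).-1 * (l.-1 * (#|F| + E')))%N.
  have -> : (l ^ k * (l * #|B|) = \sum_(e : {ffun I -> 'I_l}) l * #|B|)%N.
    by rewrite sum_nat_const card_ffun card_ord.
  have cardE0 : (\sum_(e : {ffun I -> 'I_l} | e != e0) l.-1 * (#|F| + E') =
      (l ^ k).-1 * (l.-1 * (#|F| + E')))%N.
    rewrite sum_nat_const; congr (_ * _)%N.
    by rewrite (cardC1 e0) card_ffun card_ord.
  rewrite -cardE0; apply: leq_trans (leq_add total (leqnn _)).
  rewrite big_distrr /= (bigD1 e0) //= [X in (_ <= X + _)%N](bigD1 e0) //= -addnA.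
  apply: leq_add => //; rewrite -big_split /=; apply: leq_sum => e ee0; apply: lower.
  have [/existsP[i ei]|] := boolP [exists i, (0 < e i)%N]; first by exists i.
  rewrite negb_exists => /forallP e00; case/eqP: ee0; apply/ffunP => i.
  by apply/val_inj/eqP; rewrite ffunE /= -leqn0 leqNgt e00.
have L0 : (0 < l ^ k)%N by rewrite expn_gt0 l0.
have := pair_count_bound (prime_gt1 l_pr) L0 sumlow kB.
by rewrite leqNgt -expnS big.
Qed.

(** * Numerical parameters and the bound for shifted powers *)

Lemma exists_sqrt (q : nat) : exists M, (M * M <= q < M.+1 * M.+1)%N.
Proof.
elim: q => [|q [M /andP[Mq qM]]]; first by exists 0%N.
have [lt|ge] := ltnP q.+1 (M.+1 * M.+1); first by exists M; rewrite lt (leqW Mq).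
by exists M.+1; rewrite ge /=; lia.
Qed.

(** The [m]-th powers of nonzero elements are [l]-th roots of unity; they are not all 1, as only [m]
    of the [l * m] nonzero elements can be [m]-th roots of unity. *)
Lemma exists_nontrivial_unity (F : finFieldType) (l m : nat) :
  #|F| = (l * m).+1 -> (1 < l)%N ->
  exists g : F, [/\ g ^+ l = 1, g != 0 & g != 1].
Proof.
move=> qE l1.
have m0 : (0 < m)%N.
  by rewrite lt0n; apply/eqP => m0; have := finNzRing_gt1 F; rewrite qE m0 muln0.
have [/existsP[x /andP[x0 xm]]|none] := boolP [exists x : F, (x != 0) && (x ^+ m != 1)].
  exists (x ^+ m); split; rewrite ?expf_neq0 //.
  by apply: (mulfI x0); rewrite -exprM mulnC -exprS -qE expf_card mulr1.
have : (#|[set~ (0%R : F)]| <= #|[set x : F | (x ^+ m == 1)%R]|)%N.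
  apply: subset_leq_card; apply/fintype.subsetP => x; rewrite !inE => x0.
  by apply: contraNT none => xm; apply/existsP; exists x; rewrite x0.
rewrite cardsC1 qE /= => /leq_trans/(_ (card_unity_leq F m0)).
by rewrite leqNgt ltn_Pmull.
Qed.

Lemma root_dominates (l k M : nat) :
  (1 < l)%N -> (0 < k)%N -> (l ^ (11 * k) <= M)%N ->
  (2 * l * (k * l + 2) <= M /\ l ^ k.+1 * (k + 9 * l * (k * l + 2) * M) < M * M)%N.
Proof.
move=> l1 k0 lM.
have l0 : (0 < l)%N := ltnW l1.
have kl : (k * l + 2 <= 2 * (k * l))%N.
  by have : (2 <= k * l)%N by [apply: leq_trans l1 _; rewrite leq_pmull]; lia.
(* With [19 <= 2 ^ 5 <= l ^ 5] and [k < l ^ k] the left side is below [l ^ (2 * k + 8)], and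
   [2 * k + 8 <= 11 * k] as [k] is positive. The 19 is [1 + 18], from [k * l + 2 <= 2 * (k * l)]. *)
have kM : (l ^ k.+1 * (19 * (k * l ^ 2)) < M)%N.
  apply: leq_trans lM.
  apply: (@leq_ltn_trans (l ^ k.+1 * (l ^ 5 * (k * l ^ 2)))).
    rewrite !leq_mul // (@leq_trans (2 ^ 5)) // leq_exp2r //.
  apply: (@leq_trans (l ^ k.+1 * (l ^ 5 * (l ^ k * l ^ 2)))).
    by rewrite !ltn_pmul2l ?ltn_pmul2r ?expn_gt0 ?l0 // ltn_expl.
  rewrite -!expnD leq_exp2l //; lia.
have kl2 : (k + 9 * l * (k * l + 2) <= 19 * (k * l ^ 2))%N.
  have : (k <= k * l ^ 2)%N by rewrite leq_pmulr // expn_gt0 l0.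
  by have := leq_mul (leqnn (9 * l)) kl; rewrite expnS expn1; lia.
split.
  apply: ltnW; apply: leq_ltn_trans kM; apply: (@leq_trans (1 * (19 * (k * l ^ 2)))).
    by rewrite mul1n; apply: leq_trans kl2; have := leq_addl k (9 * l * (k * l + 2)); lia.
  by rewrite leq_mul // expn_gt0 l0.
have M0 : (0 < M)%N by apply: leq_ltn_trans kM.
apply: (@leq_ltn_trans (l ^ k.+1 * (19 * (k * l ^ 2)) * M)); last by rewrite ltn_pmul2r.
rewrite -[X in (_ <= X)%N]mulnA leq_mul //; apply: leq_trans (leq_mul kl2 (leqnn M)).
by rewrite mulnDl leq_add2r leq_pmulr.
Qed.

(** As [l] divides [d], the [m]-th power of [x ^+ d] is 0 or 1. For a larger field some [b] would
    have [(b + alpha) ^+ m = g] for all [alpha] in [S], with [g] neither 0 nor 1. The exponent 22 is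
    twice 11, since [M] is about the square root of [#|F|]. *)
Lemma power_shift_cover_bound (F : finFieldType) (S : {set F}) (d l : nat) :
  prime l -> (l %| d)%N -> (0 < d)%N -> (l %| #|F| - 1)%N ->
  (forall b, exists2 alpha, alpha \in S & exists x, b + alpha = x ^+ d) ->
  (#|F| <= l ^ (22 * #|S|))%N.
Proof.
move=> l_pr /dvdnP[d1 dE] d0 /dvdnP[m qE] cover; rewrite leqNgt; apply/negP => big.
have l1 := prime_gt1 l_pr.
have {}qE : #|F| = (l * m).+1.
  by rewrite mulnC -qE subn1 prednK // ltnW // finNzRing_gt1.
have k0 : (0 < #|S|)%N by case: (cover 0) => a aS _; apply/card_gt0P; exists a.
have [M /andP[Mq qM]] := exists_sqrt #|F|.
have lM : (l ^ (11 * #|S|) <= M)%N.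
  rewrite -ltnS ltnNge; apply/negP => /(fun h => leq_mul h h) le.
  have := leq_trans (leq_trans qM le); rewrite -expnD -mulnDl => /(_ _ (ltnW big)).
  by rewrite ltnn.
have [kM bigM] := root_dominates l1 k0 lM.
have [g [gl g0 g1]] := exists_nontrivial_unity qE l1.
have := @exists_common_power F 'I_#|S| (@enum_val F (mem S)) l m M g.
rewrite card_ord => /(_ enum_val_inj qE l_pr gl Mq qM kM (leq_trans bigM Mq)) [b bg].
have [a aS [x bx]] := cover b.
have := bg (enum_rank_in aS a); rewrite enum_rankK_in // bx dE => gE.
have [x0|x0] := eqVneq x 0.
  move: gE g0; rewrite -dE x0 expr0n gtn_eqF // expr0n => <-.
  have m0 : m != 0 by apply: contraTneq (finNzRing_gt1 F) => m0; rewrite qE m0 muln0.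
  by rewrite (negPf m0) eqxx.
have xlm : x ^+ (l * m) = 1.
  by apply: (mulfI x0); rewrite -exprS -qE expf_card mulr1.
by move: gE g1; rewrite -exprM -mulnA mulnC exprM xlm expr1n => <-; rewrite eqxx.
Qed.

(** * From blocking sets to shifted powers *)

Local Open Scope classical_set_scope.

(** The span of (1, 0, 0) and (0, b, 1) is the line [y = b z]. *)
Lemma dim_sloped_line (F : finFieldType) (b : F) :
  \dim <<[:: delta_mx 0 0; b *: delta_mx 0 1 + delta_mx 0 2 : 'rV[F]_3]>> == 2%N.
Proof.
apply/eqP; set u := delta_mx 0 0; set v := _ + _.
suff : free [:: u; v] by move/eqP.
rewrite free_cons span_seq1 free_cons span_nil memv0 nil_free andbT.
apply/andP; split.
  apply/negP => /vlineP[k] /rowP uv.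
  have := uv 2; rewrite !mxE /= => /eqP.
  rewrite eq_sym mulr0 add0r mulr1 => /eqP k0.
  by have := uv 0; rewrite !mxE /= k0 mul0r => /eqP; rewrite oner_eq0.
apply/eqP => /rowP /(_ 2); rewrite !mxE /= mulr0 add0r => /eqP.
by rewrite oner_eq0.
Qed.

Lemma blocking_power_shift (F : finFieldType) (d : nat) (S : {set F}) :
  (0 < d)%N ->
  blocking_set (\bigcup_(alpha in [set` S]) curve_points d alpha) ->
  forall b, exists2 alpha, alpha \in S & exists x, b + alpha = x ^+ d.
Proof.
move=> d0 block b.
pose L : proj_line F := exist (fun L => \dim L == 2%N) _ (dim_sloped_line b).
have [P [[alpha aS Pcurve] PL]] := block L.
exists alpha => //; move: PL; rewrite /line_points /= => PL.
pose w := vpick (val P).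
have wP : w \in val P by apply: memv_pick.
have w0 : w != 0 by rewrite vpick0 -dimv_eq0; have /eqP -> := valP P.
have := subvP PL _ wP; rewrite span_cons span_seq1 => /memv_addP[u1 /vlineP[x ->]].
case=> u2 /vlineP[z ->] wE.
have w_0 : w 0 0 = x by rewrite wE !mxE /= mulr1 mulr0 addr0 mulr0 addr0.
have w_1 : w 0 1 = b * z by rewrite wE !mxE /= mulr0 add0r mulr1 addr0 mulrC.
have w_2 : w 0 2 = z by rewrite wE !mxE /= mulr0 mulr0 !add0r mulr1.
have := Pcurve w wP; rewrite /= w_0 w_1 w_2 -mulrA -exprS subn1 prednK // => eq.
(* At [z = 0] the curve equation forces [x = 0], and [y = b z] vanishes too, so there is no such
   point. Dividing by [z ^+ d] then gives [b + alpha = (x / z) ^+ d]. *)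
have z0 : z != 0.
  apply: contraNneq w0 => z0; move: eq.
  rewrite z0 expr0n gtn_eqF // !mulr0 subr0 => /esym/eqP; rewrite expf_eq0 d0 /= => /eqP x0.
  by rewrite wE x0 z0 !scale0r addr0.
exists (x / z); rewrite expr_div_n; apply: (mulIf (expf_neq0 d z0)).
by rewrite divfK ?expf_neq0 // mulrDl eq subrK.
Qed.

Theorem mainTheorem5 (R : realType) (d' : nat) (hd' : (2 <= d')%N) :
  exists c : R, 0 < c /\
    forall (F : finFieldType) (d : nat) (S : {set F}),
      (3 <= d)%N ->
      gcdn d (#|F| - 1) = d' ->
      blocking_set (\bigcup_(alpha in [set` S]) curve_points d alpha) ->
      c * ln (#|F|%:R : R) <= #|S|%:R.
Proof.
(* Choosing the prime from [d'] alone makes the constant independent of [d] and [F]; it is what the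
   logarithm of [#|F| <= l ^ (22 * #|S|)] yields. *)
pose l := pdiv d'; have l_pr : prime l := pdiv_prime hd'.
have lnl : 0 < ln (l%:R : R) by rewrite ln_gt0 // ltr1n prime_gt1.
exists (22 * ln (l%:R : R))^-1; split; first by rewrite invr_gt0 mulr_gt0.
move=> F d S d3 dE block.
have ld' : (l %| d')%N by apply: pdiv_dvd.
have d0 : (0 < d)%N by apply: leq_trans d3.
have := power_shift_cover_bound l_pr _ d0 _ (blocking_power_shift d0 block).
rewrite (dvdn_trans ld') -?dE ?dvdn_gcdl // (dvdn_trans ld') -?dE ?dvdn_gcdr //.
move=> /(_ isT isT) qS.
have q0 : (0 < #|F|)%N by apply/card_gt0P; exists 0.
rewrite ler_pdivrMl ?mulr_gt0 //.
have -> : 22 * ln l%:R * #|S|%:R = ln ((l ^ (22 * #|S|))%:R : R).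
  by rewrite natrX lnXn ?ltr0n ?prime_gt0 // -[RHS]mulr_natr natrM; ring.
by rewrite ler_ln ?posrE ?ltr0n ?ler_nat // expn_gt0 prime_gt0.
Qed.
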